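(* For each integer $n\ge 4$, $\psi_1(n)=\psi_{n-1}(n)=1$.
   Context: The wheel $W_n$ is the join of the cycle $C_n$ (the outer cycle) and a single vertex: $V(W_n)=\{v,v_1,\dots,v_n\}$ and $E(W_n)=\{vv_i,\ v_iv_{i+1} : 1\le i\le n\}$ with subscripts modulo $n$; the outer cycle $C_n$ has edges $v_iv_{i+1}$. A signed graph $\Sigma=(G,\sigma)$ is a graph $G$ together with a function $\sigma:E(G)\to\{+1,-1\}$; an edge $e$ is negative if $\sigma(e)=-1$. Switching $\Sigma$ at a vertex $u$ changes the sign of every edge incident to $u$. Two signed graphs are isomorphic if there is a graph isomorphism between their underlying graphs preserving edge signs. Two signed graphs are switching isomorphic if one is isomorphic to a signed graph obtained from the other by a sequence of switchings. $(W_n,\sigma)^o$ denotes a signed wheel all of whose negative edges lie on the outer cycle $C_n$. For $0\le p\le n$, $\psi_p(n)$ denotes the number of switching non-isomorphic signed wheels of the form $(W_n,\sigma)^o$ with exactly $p$ negative edges (the number of equivalence classes of such signed wheels under switching isomorphism). *)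

(* Defs.v *)
From HB Require Import structures.
From mathcomp Require Import all_boot.
From mathcomp Require Import boolp.

Set Implicit Arguments.
Unset Strict Implicit.
Unset Printing Implicit Defensive.

(** * Finite simple graphs *)

Record sgraph := SGraph {
  vert :> finType;
  adj : rel vert;
  adj_sym : symmetric adj;
  adj_irrefl : irreflexive adj }.

Definition edges (G : sgraph) : {set {set G}} :=
  [set [set x; y] | x in G, y in G & adj x y].

Definition edge (G : sgraph) := {e : {set G} | e \in edges G}.

(* The test [x != y] only matters for n <= 1, where it removes loops. *)
Definition cycle_adj (n : nat) : rel 'I_n :=
  [rel x y | (x != y) && ((y == ordS x) || (x == ordS y))].

Lemma cycle_adj_sym n : symmetric (@cycle_adj n).
Proof. by move=> x y; rewrite /cycle_adj /= eq_sym orbC. Qed.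

Lemma cycle_adj_irrefl n : irreflexive (@cycle_adj n).
Proof. by move=> x; rewrite /cycle_adj /= eqxx. Qed.

Definition cycle_graph (n : nat) : sgraph :=
  SGraph (@cycle_adj_sym n) (@cycle_adj_irrefl n).

Definition single_adj : rel unit := [rel _ _ | false].

Lemma single_adj_sym : symmetric single_adj. Proof. by []. Qed.
Lemma single_adj_irrefl : irreflexive single_adj. Proof. by []. Qed.

Definition single_vertex : sgraph := SGraph single_adj_sym single_adj_irrefl.

Definition join_adj (G H : sgraph) : rel (G + H) := fun x y =>
  match x, y with
  | inl a, inl b => adj a b
  | inr a, inr b => adj a b
  | _, _ => true
  end.

Lemma join_adj_sym G H : symmetric (@join_adj G H).
Proof. by move=> [a|a] [b|b] //=; apply: adj_sym. Qed.

Lemma join_adj_irrefl G H : irreflexive (@join_adj G H).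
Proof. by move=> [a|a] /=; apply: adj_irrefl. Qed.

Definition join (G H : sgraph) : sgraph :=
  SGraph (@join_adj_sym G H) (@join_adj_irrefl G H).

Definition wheel (n : nat) : sgraph := join (cycle_graph n) single_vertex.

Definition outer_cycle (n : nat) : {set {set wheel n}} :=
  [set inl @: e | e : {set cycle_graph n} in edges (cycle_graph n)].

(** * Signed graphs *)

(* The sign of an edge is (-1) ^ b for a boolean b: [true] stands for -1 and
   [false] for +1, so that changing a sign is adding [true] modulo 2. *)
Definition signature (G : sgraph) := {ffun edge G -> bool}.

Record signed_graph := SignedGraph {
  underlying :> sgraph;
  sgn : signature underlying }.

Definition neg_edges (G : sgraph) (s : signature G) : {set edge G} :=
  [set e | s e].

Definition switch_sgn (G : sgraph) (s : signature G) (u : G) : signature G :=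
  [ffun e => s e (+) (u \in val e)].

Definition switch (S : signed_graph) (us : seq S) : signed_graph :=
  SignedGraph (foldl (@switch_sgn S) (sgn S) us).

Definition is_isomorphism (S T : signed_graph) (f : S -> T) : Prop :=
  [/\ bijective f,
      forall x y : S, adj (f x) (f y) = adj x y
    & forall (e : edge S) (e' : edge T), val e' = f @: val e ->
        sgn T e' = sgn S e].

Definition isomorphic (S T : signed_graph) : Prop :=
  exists f : S -> T, is_isomorphism f.

Definition switching_isomorphic (S T : signed_graph) : Prop :=
  exists us : seq T, isomorphic S (switch us).

Lemma switchE (G : sgraph) (s : signature G) (us : seq G) (e : edge G) :
  foldl (@switch_sgn G) s us e = s e (+) odd (count (mem (val e)) us).
Proof.
elim: us s => [|u us IH] s /=; first by rewrite addbF.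
by rewrite IH ffunE oddD oddb addbA.
Qed.

Lemma imset_edge (G H : sgraph) (f : G -> H) (e : {set G}) :
  (forall x y, adj (f x) (f y) = adj x y) -> e \in edges G ->
  f @: e \in edges H.
Proof.
move=> fadj /imset2P[x y _]; rewrite inE => /andP[_ xy] ->; apply/imset2P.
by exists (f x) (f y); rewrite ?inE ?fadj // imsetU !imset_set1.
Qed.

Lemma isomorphic_sym S T : isomorphic S T -> isomorphic T S.
Proof.
move=> [f [[g fK gK] fadj fsgn]]; exists g; split; first by exists f.
  by move=> x y; rewrite -fadj !gK.
move=> e e' ee'; apply/esym/fsgn.
by rewrite ee' -imset_comp (eq_imset _ gK) imset_id.
Qed.

Lemma isomorphic_trans T S U :
  isomorphic S T -> isomorphic T U -> isomorphic S U.
Proof.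
move=> [f [fbij fadj fsgn]] [g [gbij gadj gsgn]].
exists (g \o f); split; first exact: bij_comp.
  by move=> x y /=; rewrite gadj fadj.
move=> e e'' ee''.
pose e' : edge T := Sub (f @: val e) (imset_edge fadj (valP e)).
by rewrite (gsgn e' e'') ?(fsgn e e') // ee'' imset_comp.
Qed.

Lemma isomorphic_switch (S T : signed_graph) (us : seq S) :
  isomorphic S T -> exists vs : seq T, isomorphic (switch us) (switch vs).
Proof.
move=> [f [fbij fadj fsgn]]; exists (map f us), f; split=> //= e e' ee'.
rewrite !switchE (fsgn _ _ ee') count_map; congr (_ (+) odd _).
by apply: eq_count => u /=; rewrite ee' mem_imset //; apply: bij_inj.
Qed.

Lemma switch_switch (S : signed_graph) (us : seq S) : @switch (switch us) us = S.
Proof.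
case: S us => G s us; congr SignedGraph; apply/ffunP => e.
by rewrite !switchE addbK.
Qed.

Lemma switching_isomorphic_refl S : switching_isomorphic S S.
Proof.
exists [::], id; split=> //; first exact: (Bijective (g := id)).
by move=> e e'; rewrite imset_id => /val_inj ->.
Qed.

Lemma switching_isomorphic_sym S T :
  switching_isomorphic S T -> switching_isomorphic T S.
Proof.
move=> [us /isomorphic_sym i].
have [vs] := @isomorphic_switch (switch us) S us i.
by rewrite switch_switch; exists vs.
Qed.

Lemma switching_isomorphic_trans T S U :
  switching_isomorphic S T -> switching_isomorphic T U ->
  switching_isomorphic S U.
Proof.
move=> [us iST] [vs iTU].
have [ws i] := @isomorphic_switch T (switch vs) us iTU.
exists (vs ++ ws); have := isomorphic_trans iST i.
by rewrite /switch foldl_cat.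
Qed.

(** * Counting signed wheels *)

Definition outer_signed_wheels (n p : nat) : {set signature (wheel n)} :=
  [set s | [forall e in neg_edges s, val e \in outer_cycle n] &
           #|neg_edges s| == p].

Definition psi (p n : nat) : nat :=
  #|equivalence_partition
      (fun s t : signature (wheel n) =>
         `[< switching_isomorphic (SignedGraph s) (SignedGraph t) >])
      (outer_signed_wheels n p)|.

(* Main.v *)
(** Rotations of the rim extend to automorphisms of the wheel, and they act
    transitively on the rim edges.  Hence they identify any two signatures with
    a single negative rim edge, and any two with a single positive rim edge, so
    no switching is needed. *)

Require Import Defs.
From mathcomp Require Import all_boot zify.
From mathcomp Require Import boolp.

Set Implicit Arguments.
Unset Strict Implicit.
Unset Printing Implicit Defensive.

Lemma val_iter_ordS n k (i : 'I_n) : iter k (@ordS n) i = (i + k) %% n :> nat.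
Proof.
elim: k => [|k IH] /=; first by rewrite addn0 modn_small.
by rewrite IH -addn1 modnDml addn1 addnS.
Qed.

Lemma iter_ordS_trans n (i j : 'I_n) : exists k, iter k (@ordS n) i = j.
Proof.
(* The shift is [j - i] modulo [n], with [n] added so that the natural subtraction does not
   truncate. *)
exists (j + (n - i)); apply: val_inj; rewrite /= val_iter_ordS.
by rewrite addnCA subnKC ?modnDr ?modn_small // ltnW.
Qed.

Lemma ordS_neq n (i : 'I_n) : 1 < n -> ordS i != i.
Proof.
move=> n1; rewrite -val_eqE /=; have := ltn_ord i.
rewrite leq_eqVlt => /orP[/eqP e | ?]; first by rewrite e modnn; lia.
by rewrite modn_small //; lia.
Qed.

Lemma ordS2_neq n (i : 'I_n) : 2 < n -> ordS (ordS i) != i.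
Proof.
move=> n2; rewrite -val_eqE /=; have := ltn_ord i.
(* Wrap-around at [i = n - 1] gives 1, and below at [i = n - 2] gives 0; both differ from [i]
   because [2 < n]. Otherwise the value is [i + 2]. *)
rewrite leq_eqVlt => /orP[/eqP e | ltin].
  by rewrite e modnn modn_small; lia.
rewrite (modn_small ltin); have : i.+2 <= n by [].
rewrite leq_eqVlt => /orP[/eqP e | ?]; first by rewrite e modnn; lia.
by rewrite modn_small //; lia.
Qed.

Definition rim_pair n (i : 'I_n) : {set wheel n} := [set inl i; inl (ordS i)].

Lemma rim_pair_edge n (i : 'I_n) : 1 < n -> rim_pair i \in edges (wheel n).
Proof.
move=> n1; apply/imset2P; exists (inl i) (inl (ordS i)) => //.
by rewrite !inE /= /cycle_adj /= eq_sym ordS_neq // eqxx.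
Qed.

(** Adjacency on the cycle is stated in both orientations; a rim edge is indexed by the endpoint
    whose successor is the other one. *)
Lemma outer_cycleE n : 1 < n -> outer_cycle n = [set rim_pair i | i : 'I_n].
Proof.
move=> n1; apply/setP => e; apply/imsetP/imsetP.
  case=> e' /imset2P[x y _]; rewrite inE => /andP[_ /=].
  case/andP=> _ /orP[/eqP-> -> ->|/eqP-> -> ->].
    by exists x; rewrite // imsetU !imset_set1.
  by exists y; rewrite // imsetU !imset_set1 setUC.
case=> i _ ->; exists [set i; ordS i]; last by rewrite imsetU !imset_set1.
apply/imset2P; exists i (ordS i) => //.
by rewrite !inE /= /cycle_adj /= eq_sym ordS_neq // eqxx.
Qed.

(* For [n = 2] the two rim pairs coincide. *)
Lemma rim_pair_inj n : 2 < n -> injective (@rim_pair n).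
Proof.
move=> n2 i j /setP eij.
have := eij (inl i); rewrite !inE eqxx /= => /esym/orP[/eqP[]// | /eqP[ij]].
have := eij (inl j); rewrite !inE eqxx /= => /orP[/eqP[]// | /eqP[ji]].
by have := ordS2_neq i n2; rewrite -ji -ij eqxx.
Qed.

Definition rim_edge n (n1 : 1 < n) (i : 'I_n) : edge (wheel n) :=
  Sub (rim_pair i) (rim_pair_edge i n1).

Lemma rim_edge_inj n (n1 : 1 < n) : 2 < n -> injective (rim_edge n1).
Proof. by move=> n2 i j /(congr1 val) /(rim_pair_inj n2). Qed.

Lemma outer_cycleP n (n1 : 1 < n) (e : edge (wheel n)) :
  reflect (exists i, e = rim_edge n1 i) (val e \in outer_cycle n).
Proof.
rewrite outer_cycleE //; apply: (iffP imsetP) => [[i _ ei]|[i ->]].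
  by exists i; apply: val_inj.
by exists i.
Qed.

Definition rim_map n (f : 'I_n -> 'I_n) (x : wheel n) : wheel n :=
  match x with inl i => inl (f i) | inr u => inr u end.

Lemma rim_map_bij n (f : 'I_n -> 'I_n) : bijective f -> bijective (rim_map f).
Proof.
by case=> g fK gK; exists (rim_map g); case=> // i /=; rewrite ?fK ?gK.
Qed.

(** Both clauses of [cycle_adj] survive a map that commutes with the successor and is injective;
    spokes survive because the hub is fixed. *)
Lemma rim_map_adj n (f : 'I_n -> 'I_n) :
  injective f -> {morph f : i / ordS i} ->
  forall x y : wheel n, adj (rim_map f x) (rim_map f y) = adj x y.
Proof. by move=> fI fS [i|u] [j|v] //=; rewrite /cycle_adj /= -!fS !(inj_eq fI). Qed.

Lemma rim_map_pair n (f : 'I_n -> 'I_n) i :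
  {morph f : i / ordS i} -> rim_map f @: rim_pair i = rim_pair (f i).
Proof. by move=> fS; rewrite /rim_pair imsetU !imset_set1 /= fS. Qed.

Definition neg_rim n (n1 : 1 < n) (s : signature (wheel n)) : {set 'I_n} :=
  [set i | s (rim_edge n1 i)].

(** This reduces a signature of the counted form to a subset of the [n] rim indices, whose size is
    the number of negative edges. *)
Lemma neg_edges_rim n (n1 : 1 < n) p (s : signature (wheel n)) :
  s \in outer_signed_wheels n p -> neg_edges s = rim_edge n1 @: neg_rim n1 s.
Proof.
rewrite inE => /andP[/forall_inP outs _]; apply/setP=> e.
apply/idP/imsetP => [se | [i]]; last by rewrite !inE => ? ->.
have [i ei] := outer_cycleP n1 e (outs e se).
by exists i; rewrite // inE -ei -in_set.
Qed.

Lemma card_neg_rim n (n1 : 1 < n) p (s : signature (wheel n)) :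
  2 < n -> s \in outer_signed_wheels n p -> #|neg_rim n1 s| = p.
Proof.
move=> n2 so; have := so; rewrite inE => /andP[_ /eqP <-].
by rewrite (neg_edges_rim n1 so) card_imset //; apply: rim_edge_inj.
Qed.

(** Excludes the count 0 in [psi_eq1]. The witness is the indicator of any [p] rim edges. *)
Lemma outer_signed_wheels_neq0 n p :
  2 < n -> p <= n -> exists s, s \in outer_signed_wheels n p.
Proof.
move=> n2 pn; have n1 := ltnW n2.
have [A cA] : exists A : {set 'I_n}, #|A| = p.
  (* The number of such subsets is a binomial coefficient, positive since [p <= n]. *)
  have : 0 < #|[set A : {set 'I_n} | #|A| == p]|.
    by rewrite card_draws card_ord bin_gt0.
  by case/card_gt0P=> A; rewrite inE => /eqP; exists A.
exists [ffun e => e \in rim_edge n1 @: A].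
have -> : outer_signed_wheels n p = outer_signed_wheels n #|A| by rewrite cA.
have negE : neg_edges [ffun e => e \in rim_edge n1 @: A] = rim_edge n1 @: A.
  by apply/setP=> e; rewrite inE ffunE.
rewrite inE negE card_imset ?eqxx ?andbT; last exact: rim_edge_inj.
by apply/forall_inP=> e /imsetP[i _ ei]; apply/(outer_cycleP n1); exists i.
Qed.

(** The isomorphism is [rim_map f], after the empty sequence of switchings. Signs agree on rim edges
    by the last hypothesis, and all spokes are positive on both sides. *)
Lemma switching_isomorphic_rim n (n1 : 1 < n) p q (s t : signature (wheel n))
    (f : 'I_n -> 'I_n) :
  s \in outer_signed_wheels n p -> t \in outer_signed_wheels n q ->
  bijective f -> {morph f : i / ordS i} ->
  (forall i, (f i \in neg_rim n1 t) = (i \in neg_rim n1 s)) ->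
  switching_isomorphic (SignedGraph s) (SignedGraph t).
Proof.
move=> so to fbij fS fst; have FI := bij_inj (rim_map_bij fbij).
have posE r (u : signature (wheel n)) (e : edge (wheel n)) :
    u \in outer_signed_wheels n r -> val e \notin outer_cycle n -> u e = false.
  rewrite inE => /andP[/forall_inP outu _]; apply: contraNF => ue.
  by apply: outu; rewrite inE.
exists [::], (rim_map f); split; first exact: rim_map_bij.
  exact: rim_map_adj (bij_inj fbij) fS.
move=> /= e e' ee'; case: (boolP (val e \in outer_cycle n)) => [|eo].
  case/(outer_cycleP n1) => i ei; have := fst i; rewrite !inE -ei => <-.
  by congr (t _); apply: val_inj; apply: (etrans ee'); rewrite ei /= rim_map_pair.
(* It remains to see that a spoke is not sent to a rim edge: if its image were the rim edge at [j],
   injectivity on sets would make it the rim edge at the preimage [g j]. *)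
rewrite (posE _ _ _ so eo); apply: posE to _; apply: contra eo.
case/(outer_cycleP n1) => j ej; apply/(outer_cycleP n1).
case: fbij => g fK gK; exists (g j); apply: val_inj.
by apply: (imset_inj FI); apply: (etrans (esym ee'));
   rewrite ej /= rim_map_pair // gK.
Qed.

(** If rotations act transitively on the [p]-subsets of the rim, the block of every signature is the
    whole nonempty set, so the partition is a singleton. *)
Lemma psi_eq1 n p :
  2 < n -> p <= n ->
  (forall A B : {set 'I_n}, #|A| = p -> #|B| = p ->
     exists k, forall i, (iter k (@ordS n) i \in B) = (i \in A)) ->
  psi p n = 1.
Proof.
move=> n2 pn rotAB; have n1 := ltnW n2.
have [s0 s0o] := outer_signed_wheels_neq0 n2 pn.
rewrite /psi; apply/eqP/cards1P; exists (outer_signed_wheels n p).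
apply/setP=> C; rewrite inE.
have block s : s \in outer_signed_wheels n p ->
    [set t in outer_signed_wheels n p |
      `[< switching_isomorphic (SignedGraph s) (SignedGraph t) >]]
    = outer_signed_wheels n p.
  move=> so; apply/setP=> t; rewrite in_set andb_idr // => to.
  have [k kst] := rotAB _ _ (card_neg_rim n1 n2 so) (card_neg_rim n1 n2 to).
  apply/asboolP/(switching_isomorphic_rim so to _ _ kst).
    by elim: k {kst} => [|k IH]; [exists id | apply: bij_comp (ordS_bij n) IH].
  by move=> i; rewrite -iterS iterSr.
apply/imsetP/eqP => [[s so ->]|->]; first exact: block.
by exists s0; rewrite ?block.
Qed.

Theorem lemma3p2 (n : nat) (hn : 4 <= n) : psi 1 n = 1 /\ psi (n - 1) n = 1.
Proof.
have iterI k : injective (iter k (@ordS n)).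
  by elim: k => [|k IH] i j //= /(bij_inj (ordS_bij n)) /IH.
have rot1 (A B : {set 'I_n}) : #|A| = 1 -> #|B| = 1 ->
    exists k, forall i, (iter k (@ordS n) i \in B) = (i \in A).
  move=> /eqP/cards1P[a ->] /eqP/cards1P[b ->].
  have [k kab] := iter_ordS_trans a b; exists k => i.
  by rewrite !inE -kab (inj_eq (iterI k)).
split; apply: psi_eq1; try lia; first exact: rot1.
(* For [n - 1] negative edges, rotate the unique positive edge instead: a rotation matching the
   complements of [A] and [B] also matches [A] and [B]. *)
move=> A B cA cB.
have cC (D : {set 'I_n}) : #|D| = n - 1 -> #|~: D| = 1.
  by move=> cD; have := cardsC D; rewrite card_ord cD; lia.
have [k kAB] := rot1 _ _ (cC A cA) (cC B cB).
by exists k => i; apply: negb_inj; have := kAB i; rewrite !inE.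
Qed.
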